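(* Consider the multilayer parking system with the three positions $-1,0,1$ described in the context. For every integer $h\ge 0$ and every time $t\ge 0$, the density $\rho_t^{(h+1)}(0)=\mathbb{E}\,\kappa_t(0,h+1)$ of the center position $0$ at height (layer) $h+1$ at time $t$ is $$ \begin{aligned} \rho_t^{(h+1)}(0) ={}& \sum_{k=0}^{h}\left[\binom{h}{k}\binom{h+k}{k}\left(\frac13\right)^{h+k+1}+2\binom{h}{k}\sum_{j=0}^{k-1}\binom{h+j}{j}\left(\frac13\right)^{h+j+1}\right]\\ &-\sum_{k=0}^{h}\left[\binom{h}{k}\binom{h+k}{k}\left(\frac13\right)^{h+k+1}\sum_{i=0}^{h+k}\frac{(3t)^i}{i!}+2\binom{h}{k}\sum_{j=0}^{k-1}\binom{h+j}{j}\left(\frac13\right)^{h+j+1}\sum_{i=0}^{h+j}\frac{(3t)^i}{i!}\right]e^{-3t}, \end{aligned} $$ where empty sums (the sums over $0\le j\le k-1$ when $k=0$) are $0$.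
   Context: The three-position multilayer parking (particle deposition) system is defined as follows. The sites are pairs $(x,r)$ with position $x\in\{-2,-1,0,1,2\}$ and layer (height) $r\in\{1,2,3,\dots\}$. Particles arrive at the positions $x\in\{-1,0,1\}$ according to independent Poisson processes $(N_t(x))_{t\ge 0}$ of rate $1$, where $N_t(x)$ is the number of arrivals at position $x$ up to time $t$; no particles arrive at the boundary positions: $N_t(-2)=N_t(2)=0$ for all $t$. (Almost surely no two arrivals are simultaneous.) Let $\kappa_t(x,r)=1$ if there is a particle at site $(x,r)$ at time $t$, and $\kappa_t(x,r)=0$ otherwise. At time $0$ all sites are empty. For $x\in\{-1,0,1\}$ let $N_x=\{x-1,x,x+1\}$ be the set consisting of $x$ and the positions at distance $1$ from it. When a particle arrives at position $x$ at time $t$, it is deposited permanently at site $(x,r)$ with $r=h_t(x):=\min\{r\ge 1:\kappa(y,r)=0 \text{ for all } y\in N_x\}$, where $\kappa$ is the configuration immediately before the arrival. (So a particle always goes to the lowest layer in which its own position and the neighboring positions are empty; there is no screening by higher particles.) The density of site $(x,r)$ at time $t$ is $\rho_t(x,r)=\mathbb{E}\,\kappa_t(x,r)$, also written $\rho_t^{(r)}(x)$. *)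

(* Defs.v *)
From HB Require Import structures.
From mathcomp Require Import all_boot all_order all_algebra finmap.
From mathcomp Require Import all_classical all_reals all_analysis.

Set Implicit Arguments.
Unset Strict Implicit.
Unset Printing Implicit Defensive.

Import Order.TTheory GRing.Theory Num.Theory.
Import numFieldNormedType.Exports.

Local Open Scope classical_set_scope.
Local Open Scope ring_scope.

Section Independence.
Context d (Omega : measurableType d) (R : realType) (P : probability Omega R).

Definition mutually_independent (I : choiceType) (D : set I)
    (F : I -> set (set Omega)) : Prop :=
  forall (J : {fset I}) (E : I -> set Omega),
    [set` J] `<=` D -> (forall i, i \in J -> F i (E i)) ->
    P (\bigcap_(i in [set` J]) E i) = (\prod_(i <- J) P (E i))%E.

Definition independent_variables (I : choiceType) (D : set I)
    d' (T : measurableType d') (X : I -> Omega -> T) : Prop :=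
  mutually_independent D (fun i => preimage_set_system setT (X i) measurable).

Definition sigma_algebra_of_process d' (T : measurableType d')
    (X : R -> Omega -> T) : set (set Omega) :=
  <<s \bigcup_(t in [set t : R | 0 <= t])
        preimage_set_system setT (X t) measurable >>.

Definition independent_processes (I : choiceType) (D : set I)
    d' (T : measurableType d') (X : I -> R -> Omega -> T) : Prop :=
  mutually_independent D (fun i => sigma_algebra_of_process (X i)).

End Independence.

Section PoissonProcess.
Context d (Omega : measurableType d) (R : realType) (P : probability Omega R).

(* The time index ranges over all of R, but only the times t >= 0 are
   constrained. The natural-number subtraction in [increment] is a true
   difference for s <= t, because paths are nondecreasing. *)
Definition increment (N : R -> Omega -> nat) (s t : R) : Omega -> nat :=
  fun w => (N t w - N s w)%N.

Record poisson_process (rate : R) (N : R -> {RV P >-> nat}) : Prop := {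
  poisson_rate_gt0 : 0 < rate;
  poisson_at0 : forall w, N 0 w = 0%N;
  poisson_nondecreasing : forall w (s t : R),
    0 <= s -> s <= t -> (N s w <= N t w)%N;
  poisson_right_continuous : forall w (t : R),
    0 <= t -> \forall s \near t^'+, N s w = N t w;
  poisson_increment : forall (s t : R) (k : nat), 0 <= s -> s < t ->
    P [set w | increment N s t w = k] =
      (poisson_pmf (rate * (t - s)) k)%:E;
  poisson_independent_increments : forall u : nat -> R,
    0 <= u 0%N -> (forall i, u i <= u i.+1) ->
    independent_variables P setT (fun i : nat => increment N (u i) (u i.+1))
}.

End PoissonProcess.

Section Parking.

Definition positions : seq int := [:: -2; -1; 0; 1; 2].
Definition arrival_positions : seq int := [:: -1; 0; 1].

(* [c x r] tells whether the site (x, r) is occupied; only x in [positions]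
   and r >= 1 are meaningful. *)
Definition configuration := int -> nat -> bool.

Definition neighborhood (x : int) : seq int := [:: x - 1; x; x + 1].

Definition vacant (c : configuration) (x : int) (r : nat) : bool :=
  all (fun y => ~~ c y r) (neighborhood x).

(* r = min {q >= 1 | c y q = 0 for all y in N_x} *)
Definition landing_layer (c : configuration) (x : int) (r : nat) : Prop :=
  [/\ (1 <= r)%N, vacant c x r &
      forall q, (1 <= q)%N -> vacant c x q -> (r <= q)%N].

Context {R : realType}.

(* A jump of the counting path n at time t. *)
Definition arrives (n : R -> nat) (t : R) : Prop :=
  0 < t /\ forall s, 0 <= s -> s < t -> (n s < n t)%N.

(* Evolution of the configurations along one realization n of the arrivals.
   In [deposition], s is a time just before t, so that c s is the
   configuration immediately before the arrivals at time t. *)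
Record parking_path (n : int -> R -> nat) (c : R -> configuration) : Prop := {
  initially_empty : forall x r, x \in positions -> (1 <= r)%N ->
    ~~ c 0 x r;
  no_arrival : forall s t : R, 0 <= s -> s <= t ->
    (forall x, x \in positions -> n x s = n x t) ->
    forall x r, x \in positions -> (1 <= r)%N -> c t x r = c s x r;
  deposition : forall t : R, 0 < t -> \forall s \near t^'-,
    forall x r, x \in positions -> (1 <= r)%N ->
      c t x r <-> c s x r \/ (arrives (n x) t /\ landing_layer (c s) x r)
}.

Context d (Omega : measurableType d) (P : probability Omega R).

Record parking_system (N : int -> R -> {RV P >-> nat})
    (kappa : R -> int -> nat -> {RV P >-> bool}) : Prop := {
  arrivals_poisson : forall x, x \in arrival_positions ->
    poisson_process 1 (N x);
  arrivals_independent :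
    independent_processes P [set` arrival_positions] N;
  no_boundary_arrivals : forall x t w, x \in [:: -2; 2 : int] -> 0 <= t ->
    N x t w = 0%N;
  parking_dynamics : \forall w \ae P,
    parking_path (fun x t => N x t w) (fun t x r => kappa t x r w)
}.

Definition density (kappa : R -> int -> nat -> {RV P >-> bool})
    (t : R) (x : int) (r : nat) : \bar R :=
  'E_P[fun w => (kappa t x r w)%:R].

End Parking.

(* Main.v *)
Require Import Defs.
From mathcomp Require Import all_boot all_order all_algebra finmap.
From mathcomp Require Import all_classical all_reals all_analysis.
From mathcomp Require Import zify ring lra.

(** A particle at position 0 needs a completely empty layer, and particles at
    -1 and 1 do not see each other. Hence the layers that are not taken by
    center particles are filled from below, independently on the two sides,
    and with [n x] arrivals at x the nonempty layers are exactly the layers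
    1, ..., H with
      H = n 0 + max (n (-1)) (n 1)
    ([height]). A center particle always lands in layer H + 1
    ([landing_center]), so site (0, h + 1) becomes occupied at the one center
    arrival that finds H = h. Center arrivals have rate 1, therefore the
    density is the integral over [0, t] of
      P (H_s = h) = sum_k p_(h-k) (p_k ^ 2 + 2 p_k sum_(j < k) p_j),
    where p_i = s ^ i e ^ (- s) / i! ([height_pmf]); k is the maximum of the
    two side counts. Integrating s ^ n e ^ (- 3 s) termwise gives the tails
    1 - e ^ (- 3 t) sum_(i <= n) (3 t) ^ i / i! and the binomial coefficients
    ([pois_product]).

    No stochastic integral is needed. On a short interval (a, b] two or more
    arrivals have probability at most 6 (b - a) ^ 2 ([pr_busy]). With at most
    one arrival, the deterministic step [path_step] describes both how the
    shape of the configuration persists and when (0, h + 1) gets occupied.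
    This is used twice: along finer and finer meshes of [0, a] it shows that
    almost surely the configuration at time a has the expected shape
    ([stacked_ae]); on a single interval (a, b] it gives
      f b - f a = (b - a) e ^ (- (b - a)) P (H_a = h) + O ((b - a) ^ 2)
    for f the occupation probability of (0, h + 1) ([occupation_step]). This
    one-sided estimate and the continuity of P (H_s = h) in s make f
    differentiable for s > 0 with derivative P (H_s = h), and the mean value
    theorem identifies f with the explicit formula ([forward_integral]). *)

Set Implicit Arguments.
Unset Strict Implicit.
Unset Printing Implicit Defensive.

Import Order.TTheory GRing.Theory Num.Theory.
Import numFieldNormedType.Exports.

Local Open Scope classical_set_scope.
Local Open Scope ring_scope.

(** * The shape of reachable configurations *)

(** For a layer r without center particle this is its rank, counted from 1,
    among the layers without center particle. *)
Definition free_rank (c : configuration) (r : nat) : nat :=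
  (\sum_(1 <= q < r.+1) ~~ c 0%R q)%N.

Definition height (n : int -> nat) : nat := (n 0%R + maxn (n (-1)%R) (n 1%R))%N.

(** The invariant of the dynamics when [n] counts the arrivals. The first field
    says at once that no center particle lies above layer [height n] and that
    there are [n 0] of them below; the second says that side x occupies the
    first [n x] layers left free by the center. *)
Record stacked (c : configuration) (n : int -> nat) : Prop := {
  center_packed : forall r, (height n <= r)%N -> (free_rank c r + n 0%R = r)%N;
  sides_packed : forall x r, x \in [:: -1; 1 : int] -> (1 <= r)%N ->
    c x r = ~~ c 0 r && (free_rank c r <= n x)%N;
  boundary_vacant : forall x r, x \in [:: -2; 2 : int] -> (1 <= r)%N ->
    ~~ c x r
}.

Lemma free_rank0 c : free_rank c 0 = 0%N.
Proof. by rewrite /free_rank big_geq. Qed.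

Lemma free_rankS c r : free_rank c r.+1 = (free_rank c r + ~~ c 0%R r.+1)%N.
Proof. by rewrite /free_rank big_nat_recr. Qed.

Lemma free_rank_le c r s : (r <= s)%N -> (free_rank c r <= free_rank c s)%N.
Proof.
elim: s => [|s IH]; first by rewrite leqn0 => /eqP->.
rewrite leq_eqVlt => /predU1P[-> //|rs]; rewrite free_rankS.
exact: leq_trans (IH _) (leq_addr _ _).
Qed.

Lemma free_rank_lt c r s : (r < s)%N -> ~~ c 0 s ->
  (free_rank c r < free_rank c s)%N.
Proof.
case: s => // s rs c0s; rewrite free_rankS c0s addn1 ltnS.
exact: free_rank_le.
Qed.

Lemma eq_free_rank c c' r :
  (forall q, (1 <= q <= r)%N -> c 0 q = c' 0 q) ->
  free_rank c r = free_rank c' r.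
Proof.
by move=> cc'; apply: eq_big_nat => q qr; rewrite cc'//; lia.
Qed.

Lemma landing_layer_inj c x r s :
  landing_layer c x r -> landing_layer c x s -> r = s.
Proof.
move=> [r1 vr ur] [s1 vs us]; apply/eqP.
by rewrite eqn_leq ur// us.
Qed.

Lemma vacant0 c r :
  vacant c 0 r = [&& ~~ c (-1) r, ~~ c 0 r & ~~ c 1 r].
Proof. by rewrite /vacant/= andbT. Qed.

Lemma vacantN1 c r :
  vacant c (-1) r = [&& ~~ c (-2) r, ~~ c (-1) r & ~~ c 0 r].
Proof. by rewrite /vacant/= andbT. Qed.

Lemma vacant1 c r :
  vacant c 1 r = [&& ~~ c 0 r, ~~ c 1 r & ~~ c 2 r].
Proof. by rewrite /vacant/= andbT. Qed.

(** Up to layer [height n] every layer without center particle has rank at most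
    max (n (-1)) (n 1), so one of the two sides occupies it. *)
Lemma landing_center c n r : stacked c n ->
  landing_layer c 0 r <-> r = (height n).+1.
Proof.
move=> [cP sP bP]; have sL := sP (-1); have sR := sP 1.
have land : landing_layer c 0 (height n).+1.
  have := cP _ (leqnn _); have := cP _ (leqnSn (height n)).
  rewrite free_rankS => e1 e2.
  have c0 : ~~ c 0 (height n).+1 by case: (c 0 _) e1 => //=; lia.
  have rk : free_rank c (height n).+1 = (maxn (n (-1)%R) (n 1%R)).+1.
    by rewrite free_rankS c0; move: e2; rewrite /height; lia.
  split=> //.
    rewrite vacant0 c0 sL// sR// rk c0/=.
    by rewrite -!ltnNge !ltnS leq_maxl leq_maxr.
  move=> q q1; rewrite vacant0 => /and3P[].
  rewrite sL// sR// => vl c0q vr.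
  rewrite ltnNge; apply/negP => qh.
  have := free_rank_le c qh; move: vl vr e2; rewrite c0q /= /height.
  by move: (n (-1)) (n 1) (n 0); lia.
by split=> [/landing_layer_inj/(_ land)//|->].
Qed.

(** Only finitely many layers hold center particles, so the rank is unbounded;
    the least layer where it exceeds k is free and has rank exactly k + 1. *)
Lemma free_rank_surj c n k : stacked c n ->
  exists2 r, (1 <= r)%N & ~~ c 0 r /\ free_rank c r = k.+1.
Proof.
move=> [cP _ _].
have ex : exists r, (k.+1 <= free_rank c r)%N.
  exists (height n + k.+1)%N; have := cP (height n + k.+1)%N (leq_addr _ _).
  by rewrite /height; move: (free_rank c _); lia.
case: (ex_minnP ex) => -[|r]; rewrite ?free_rank0// free_rankS => kr rmin.
have : (free_rank c r <= k)%N.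
  by rewrite leqNgt; apply/negP => /rmin; rewrite ltnn.
exists r.+1 => //; rewrite free_rankS; case: (c 0 r.+1) kr => /=; lia.
Qed.

(** A layer without center particle is vacant for side x exactly when its rank
    exceeds [n x], and the lowest such layer has rank [n x] + 1. *)
Lemma landing_side c n x r : stacked c n -> x \in [:: -1; 1 : int] ->
  landing_layer c x r <->
  [/\ (1 <= r)%N, ~~ c 0 r & free_rank c r = (n x).+1].
Proof.
move=> st xs; have [_ sP bP] := st.
have vac q : (1 <= q)%N -> vacant c x q = ~~ c 0 q && (n x < free_rank c q)%N.
  move=> q1; move: xs; rewrite !inE => /orP[]/eqP->.
    by rewrite vacantN1 bP// (sP (-1))// ltnNge; case: (c 0 q) => //=;
      rewrite andbT.
  by rewrite vacant1 (bP 2)// (sP 1)// ltnNge; case: (c 0 q) => //=;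
      rewrite andbT.
have land s : [/\ (1 <= s)%N, ~~ c 0 s & free_rank c s = (n x).+1] ->
    landing_layer c x s.
  move=> [s1 c0 rk]; split; rewrite ?vac ?c0 ?rk//=.
  move=> q q1; rewrite vac// => /andP[c0q nq]; rewrite leqNgt; apply/negP.
  by move=> /free_rank_lt/(_ c0); rewrite rk ltnS leqNgt nq.
split=> [lr|/land//].
have [s s1 [c0 rk]] := free_rank_surj (n x) st.
by rewrite (landing_layer_inj lr (land _ (And3 s1 c0 rk))).
Qed.

Lemma arrival_positionsP (x : int) : x \in arrival_positions ->
  x = 0 \/ x \in [:: -1; 1 : int].
Proof.
by rewrite !inE => /or3P[]/eqP->; [right|left|right].
Qed.

Lemma arrival_subset x : x \in arrival_positions -> x \in positions.
Proof. by rewrite !inE => /or3P[]/eqP->. Qed.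

Lemma stacked_eq c c' n n' : stacked c n ->
  (forall x r, x \in positions -> (1 <= r)%N -> c' x r = c x r) ->
  (forall x, x \in arrival_positions -> n' x = n x) ->
  stacked c' n'.
Proof.
move=> [cP sP bP] cc nn.
have rk r : free_rank c' r = free_rank c r.
  by apply: eq_free_rank => q /andP[q1 _]; rewrite cc.
have hh : height n' = height n by rewrite /height !nn.
split.
- by move=> r; rewrite hh rk nn//; exact: cP.
- move=> x r xs r1; have xa : x \in arrival_positions.
    by move: xs; rewrite !inE => /orP[]->//; rewrite !orbT.
  by rewrite !cc ?arrival_subset// rk nn// sP.
- move=> x r xb r1; rewrite cc ?bP//.
  by move: xb; rewrite !inE => /orP[]->//; rewrite !orbT.
Qed.

(** A side deposit fills the layer of rank [n x0] + 1. A center deposit takes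
    layer K + 1 with K the old height: ranks up to K do not change, and above K
    they drop by 1 but still exceed both side counts. *)
Lemma stacked_deposit (c c' : configuration) n n' x0 : stacked c n ->
  x0 \in arrival_positions ->
  (forall x r, x \in positions -> (1 <= r)%N ->
     c' x r <-> c x r \/ (x = x0 /\ landing_layer c x0 r)) ->
  n' x0 = (n x0).+1 ->
  (forall x, x \in arrival_positions -> x != x0 -> n' x = n x) ->
  stacked c' n'.
Proof.
move=> st x0a cc n'x0 nn; have [cP sP bP] := st.
have stay x r : x \in positions -> (1 <= r)%N -> x != x0 -> c' x r = c x r.
  move=> xp r1 xx0; apply/idP/idP; last by move=> h; apply/cc => //; left.
  by move/cc => -[]// -[] xE; rewrite xE eqxx in xx0.
have bnd x r : x \in [:: -2; 2 : int] -> (1 <= r)%N -> ~~ c' x r.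
  move=> xb r1; rewrite stay ?bP//.
    by move: xb; rewrite !inE => /orP[]->//; rewrite !orbT.
  by move: xb x0a; rewrite !inE => /orP[]/eqP-> /or3P[]/eqP->.
case: (arrival_positionsP x0a) => [x00|x0s].
  subst x0; set K := height n.
  have c0E r : (1 <= r)%N -> c' 0 r = c 0 r || (r == K.+1).
    move=> r1; apply/idP/idP.
      by move/cc => -[]// => [->//|[_ /(landing_center _ st)->]];
        rewrite eqxx orbT.
    move=> h; apply/cc => //; case/orP: h => [->|/eqP rK]; first by left.
    by right; split => //; apply/(landing_center _ st).
  have e := cP K (leqnn _); have := cP _ (leqnSn K).
  rewrite free_rankS => e1.
  have cK : ~~ c 0 K.+1 by case: (c 0 _) e1 => //=; lia.
  have n1 : n' (-1) = n (-1) by apply: nn.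
  have n2 : n' 1 = n 1 by apply: nn.
  have hE : height n' = K.+1 by rewrite /height n'x0 n1 n2.
  have rkl r : (r <= K)%N -> free_rank c' r = free_rank c r.
    move=> rK; apply: eq_free_rank => q /andP[q1 qr]; rewrite c0E//.
    by rewrite (_ : (q == K.+1) = false) ?orbF//; lia.
  have rkg r : (K < r)%N -> ((free_rank c' r).+1 = free_rank c r)%N.
    elim: r => // r IH; rewrite ltnS leq_eqVlt => /predU1P[<-|Kr].
      by rewrite !free_rankS rkl// c0E// eqxx orbT/= cK addn0 addn1.
    rewrite !free_rankS -addSn IH// c0E//.
    by rewrite (_ : (r.+1 == K.+1) = false) ?orbF//; lia.
  split=> //.
    move=> r; rewrite hE n'x0 => Kr; have := cP r (ltnW Kr).
    by have := rkg _ Kr; lia.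
  move=> x r xs r1; rewrite stay//; first last.
  - by move: xs; rewrite !inE => /orP[]/eqP->.
  - by move: xs; rewrite !inE => /orP[]/eqP->.
  have nx : n' x = n x.
    by move: xs; rewrite !inE => /orP[]/eqP->.
  have nxm : (n x + n 0%R <= K)%N.
    by move: xs; rewrite !inE /K /height => /orP[]/eqP->; lia.
  rewrite sP// c0E// nx; case: (leqP r K) => rK.
    by rewrite rkl// (_ : (r == K.+1) = false) ?orbF//; lia.
  case: eqP => [->|/eqP rK1]; rewrite ?orbT ?orbF/=.
    by rewrite cK/= free_rankS cK; lia.
  have := cP _ (ltnW rK); have := rkg _ rK.
  by case: (c 0 r) => //=; lia.
have c0E r : (1 <= r)%N -> c' 0 r = c 0 r.
  by move=> r1; rewrite stay//; move: x0s; rewrite !inE => /orP[]/eqP->.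
have rk r : free_rank c' r = free_rank c r.
  by apply: eq_free_rank => q /andP[q1 _]; exact: c0E.
have n0 : n' 0 = n 0.
  by apply: nn => //; move: x0s; rewrite !inE => /orP[]/eqP->.
have hh : (height n <= height n')%N.
  move: x0s; rewrite /height n0 !inE => /orP[]/eqP xE; subst x0.
    by rewrite n'x0 (nn 1)//; lia.
  by rewrite n'x0 (nn (-1))//; lia.
split=> //.
  move=> r rh; rewrite rk n0; apply: cP; exact: leq_trans rh.
move=> x r xs r1; rewrite rk c0E//.
have xa : x \in arrival_positions.
  by move: xs; rewrite !inE => /orP[]->//; rewrite !orbT.
have [xx0|xx0] := eqVneq x x0; last by rewrite stay ?arrival_subset// nn// sP.
rewrite xx0 in xs xa *; rewrite n'x0; apply/idP/idP.
  move=> /cc -[]//; rewrite ?arrival_subset//.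
    by rewrite sP// => /andP[->]/=; lia.
  by move=> [_ /(landing_side _ st xs)[_ ->->]]/=.
move=> /andP[c0 ]; rewrite leq_eqVlt => /predU1P[e|e]; apply/cc => //.
- exact: arrival_subset.
- by right; split => //; apply/(landing_side _ st xs).
- exact: arrival_subset.
- by left; rewrite sP// c0.
Qed.

Lemma stacked_init c :
  (forall x r, x \in positions -> (1 <= r)%N -> ~~ c x r) ->
  stacked c (fun=> 0%N).
Proof.
move=> c0.
have rk r : free_rank c r = r.
  elim: r => [|r IH]; first by rewrite free_rank0.
  by rewrite free_rankS IH c0// addn1.
split.
- by move=> r _; rewrite rk addn0.
- move=> x r xs r1; rewrite rk leqNgt r1 andbF; apply/negbTE/c0 => //.
  by move: xs; rewrite !inE => /orP[]->//; rewrite !orbT.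
- move=> x r xs r1; apply/c0 => //.
  by move: xs; rewrite !inE => /orP[]->//; rewrite !orbT.
Qed.

Lemma stacked_top_vacant c n : stacked c n -> ~~ c 0 (height n).+1.
Proof.
move=> st; have /(landing_center _ st)[_ + _] := erefl (height n).+1.
by rewrite vacant0 => /and3P[].
Qed.

(** * Deposition along one realization of the arrivals *)

Record counting_paths {R : realType} (n : int -> R -> nat) : Prop := {
  counts_at0 : forall x, x \in positions -> n x 0 = 0%N;
  counts_nondecreasing : forall x (s t : R), x \in positions ->
    0 <= s -> s <= t -> (n x s <= n x t)%N;
  counts_right_continuous : forall x (t : R), x \in positions ->
    0 <= t -> \forall s \near t^'+, n x s = n x t;
  counts_boundary : forall x t, x \in [:: -2; 2 : int] -> 0 <= t ->
    n x t = 0%N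
}.

Definition total_count {R : realType} (n : int -> R -> nat) (t : R) : nat :=
  (n (-1)%R t + n 0%R t + n 1%R t)%N.

(** The jump time is the supremum of the times in [a, b] at which f still has
    the value f a; right-continuity puts the new value at the supremum. *)
Lemma unit_jump {R : realType} (f : R -> nat) (a b : R) :
  (forall s t, a <= s -> s <= t -> (f s <= f t)%N) ->
  (forall t, a <= t -> \forall s \near t^'+, f s = f t) ->
  a <= b -> f b = (f a).+1 ->
  exists t, [/\ a < t, t <= b, forall s, a <= s -> s < t -> f s = f a
    & f t = f b].
Proof.
move=> mf rcf ab fb.
pose S := [set s | a <= s <= b /\ f s = f a].
have Sa : S a by split; rewrite ?lexx.
have ubS : ubound S b by move=> s [/andP[]].
have hsS : has_sup S by split; [exists a|exists b].
have at_ : a <= sup S by apply: ub_le_sup => //; exists b.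
have tb : sup S <= b by apply: ge_sup => //; exists a.
have before s : a <= s -> s < sup S -> f s = f a.
  move=> as_ /sup_gt[]; first by exists a.
  move=> u [/andP[au ub] fu] su; apply/eqP; rewrite eqn_leq -{1}fu.
  by rewrite !mf// ltW.
have jump : f (sup S) != f a.
  apply/eqP => fS; have Sb : sup S < b.
    rewrite lt_neqAle tb andbT; apply/eqP => Sb.
    by move: fb; rewrite -Sb fS => /n_Sn.
  have [u [[Su ub] fu]] := filter_ex (filterI (filterI
    (nbhs_right_gt (sup S)) (nbhs_right_lt Sb)) (rcf _ at_)).
  suff : u <= sup S by rewrite leNgt Su.
  apply: ub_le_sup; first by exists b.
  by split; [rewrite (le_trans at_) ?ltW|rewrite fu].
exists (sup S); split=> //.
- rewrite lt_neqAle at_ andbT; apply/eqP => aS; move: jump.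
  by rewrite -aS eqxx.
- have := mf _ _ at_ tb; have := mf _ _ (lexx a) at_; move: jump.
  by rewrite fb; lia.
Qed.

(** With at most one arrival in (a, b] either nothing happens, or the only
    change is the deposit at the jump time, made in the configuration c a. Site
    (0, h + 1) is then filled exactly by a center arrival that finds h nonempty
    layers. *)
Lemma path_step {R : realType} (n : int -> R -> nat) (c : R -> configuration)
    (a b : R) :
  counting_paths n -> parking_path n c -> 0 <= a -> a <= b ->
  (total_count n b <= (total_count n a).+1)%N ->
  stacked (c a) (fun x => n x a) ->
  stacked (c b) (fun x => n x b) /\
  forall h, c b 0 h.+1 =
    c a 0 h.+1 || (n 0 b == (n 0 a).+1) && (height (fun x => n x a) == h).
Proof.
move=> [_ mono rc bd] [_ na dep] a0 ab tot st.
have b0 := le_trans a0 ab.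
have incr x : x \in positions -> (n x a <= n x b)%N by move=> ?; exact: mono.
have [same|[x0 x0a [nx0 others]]] :
    (forall x, x \in arrival_positions -> n x b = n x a) \/
    exists2 x0, x0 \in arrival_positions & n x0 b = (n x0 a).+1 /\
      forall x, x \in arrival_positions -> x != x0 -> n x b = n x a.
  have := incr (-1) erefl; have := incr 0 erefl; have := incr 1 erefl.
  move: tot; rewrite /total_count => tot i1 i0 iN.
  have : [\/ [/\ n (-1) b = n (-1) a, n 0 b = n 0 a & n 1 b = n 1 a],
     [/\ n (-1) b = (n (-1) a).+1, n 0 b = n 0 a & n 1 b = n 1 a],
     [/\ n (-1) b = n (-1) a, n 0 b = (n 0 a).+1 & n 1 b = n 1 a] |
     [/\ n (-1) b = n (-1) a, n 0 b = n 0 a & n 1 b = (n 1 a).+1]].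
    move: (n (-1) b) (n (-1) a) (n 0 b) (n 0 a) (n 1 b) (n 1 a) tot i1 i0 iN.
    move=> u u' v v' w w' h1 h2 h3 h4.
    have [e1|e1] := eqVneq u u'; have [e2|e2] := eqVneq v v';
    have [e3|e3] := eqVneq w w'; first [constructor 1; split; lia
      |constructor 2; split; lia|constructor 3; split; lia
      |constructor 4; split; lia|exfalso; lia].
  case=> -[e1 e2 e3]; [left|right; exists (-1)|right; exists 0|right; exists 1];
    rewrite //; first 1 last; [split=> //|split=> //|split=> //|];
    by move=> x; rewrite !inE => /or3P[]/eqP->.
- have samep x : x \in positions -> n x a = n x b.
    by rewrite !inE => /or4P[|||/orP[]] /eqP->;
      first [by rewrite !bd|by rewrite same].
  have cE x r : x \in positions -> (1 <= r)%N -> c b x r = c a x r.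
    exact: na.
  split; first exact: stacked_eq st cE same.
  by move=> h; rewrite cE// same// (ltn_eqF (ltnSn _))/= orbF.
have others' x : x \in positions -> x != x0 -> n x b = n x a.
  rewrite !inE => /or4P[|||/orP[]] /eqP->; first [by rewrite !bd|exact: others].
have x0p := arrival_subset x0a.
(* t is the time of the only arrival, at x0. *)
have [t [at_ tb before nt]] : exists t, [/\ a < t, t <= b,
    forall s, a <= s -> s < t -> n x0 s = n x0 a & n x0 t = n x0 b].
  apply: unit_jump => // [s t as_ st'|t at_].
    by apply: mono => //; exact: le_trans as_.
  by apply: rc => //; exact: le_trans at_.
have t0 : 0 < t by exact: le_lt_trans at_.
have [s [[as_ st'] deps]] := filter_ex (filterI (filterI
  (nbhs_left_gt at_) (nbhs_left_lt t)) (dep t t0)).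
have stays x u : x \in positions -> x != x0 -> a <= u -> u <= b ->
    n x u = n x a.
  move=> xp xx0 au ub; apply/eqP; rewrite eqn_leq -{1}(others' x)//.
  by rewrite !mono// (le_trans a0).
have cs x r : x \in positions -> (1 <= r)%N -> c s x r = c a x r.
  move=> xp r1; apply: na => //; first exact: ltW.
  move=> y yp; have [->|yx0] := eqVneq y x0; first by rewrite before// ltW.
  by rewrite stays// ltW// (lt_le_trans st').
have cb x r : x \in positions -> (1 <= r)%N -> c b x r = c t x r.
  move=> xp r1; apply: na => //; first exact: ltW.
  move=> y yp; have [->//|yx0] := eqVneq y x0.
  by rewrite !stays// ltW.
have arr x : x \in positions -> arrives (n x) t <-> x = x0.
  move=> xp; split=> [[_ /(_ a a0 at_)]|->].
    by have [//|xx0] := eqVneq x x0; rewrite stays ?ltnn// ltW.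
  split=> // u u0 ut; rewrite nt nx0 ltnS; have [ua|au] := leP u a.
    exact: mono.
  by rewrite before// ltW.
have land x r : x \in arrival_positions ->
    landing_layer (c s) x r <-> landing_layer (c a) x r.
  move=> xa; have vE q : (1 <= q)%N -> vacant (c s) x q = vacant (c a) x q.
    move=> q1; move: xa; rewrite !inE => /or3P[]/eqP->.
    - by rewrite !vacantN1 !cs.
    - by rewrite !vacant0 !cs.
    - by rewrite !vacant1 !cs.
  split=> -[r1 v u]; (split; rewrite // -?vE// ?vE// => q q1 vq).
    by apply: u; rewrite ?vE.
  by apply: u; rewrite -?vE.
have cE x r : x \in positions -> (1 <= r)%N ->
    c b x r <-> c a x r \/ (x = x0 /\ landing_layer (c a) x0 r).
  move=> xp r1; rewrite cb//; have := deps x r xp r1; rewrite cs// => ->.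
  split=> -[h|[h1 h2]]; [by left|right|by left|right].
    by have xx0 := (arr x xp).1 h1; split=> //; apply/(land x0 r x0a);
      rewrite -xx0.
  by split; [apply/(arr x xp)|rewrite h1; apply/(land x0 r x0a)].
split; first exact: stacked_deposit st x0a cE nx0 others.
move=> h; apply/idP/idP.
  move/cE => -[]// => [->//|[x00]]; subst x0.
  by move/(landing_center _ st) => [->]; rewrite nx0 !eqxx orbT.
move=> /orP[ca|/andP[/eqP n0 /eqP hE]]; apply/cE => //; first by left.
right; have x00 : 0 = x0.
  apply/eqP/negPn/negP => /others; rewrite n0 => /(_ erefl)/esym.
  exact: n_Sn.
by split=> //; rewrite -x00; apply/(landing_center _ st); rewrite hE.
Qed.

(** * Probabilities as real numbers, and Poisson increments *)

(** The measurable type is kept abstract because the lemma serves both for the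
    ambient sigma-algebra and for the one generated by a single process. *)
Lemma measurable_rel2 d (T : measurableType d) (f g : T -> nat)
    (Q : nat -> nat -> Prop) :
  (forall i, measurable (f @^-1` [set i])) ->
  (forall i, measurable (g @^-1` [set i])) ->
  measurable [set w | Q (f w) (g w)].
Proof.
move=> mf mg; rewrite (_ : [set w | _] =
  \bigcup_i \bigcup_(j in Q i) (f @^-1` [set i] `&` g @^-1` [set j])).
  apply: bigcup_measurable => i _; apply: bigcup_measurable => j _.
  exact: measurableI.
apply/seteqP; split=> [w Qw|w [i _ [j Qij [/= fi gj]]]];
  last by rewrite /= fi gj.
by exists (f w) => //; exists (g w).
Qed.

Lemma independent_seq d (Omega : measurableType d) (R : realType)
    (P : probability Omega R) (I : choiceType) (D : set I)
    (F : I -> set (set Omega)) (s : seq I) (E : I -> set Omega) :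
  mutually_independent P D F -> uniq s -> (forall i, i \in s -> D i) ->
  (forall i, i \in s -> F i (E i)) ->
  P (\bigcap_(i in [set` s]) E i) = (\prod_(i <- s) P (E i))%E.
Proof.
move=> ind us sD FE; have mem i : (i \in [fset j in s]%fset) = (i \in s).
  by rewrite in_fset.
rewrite (_ : [set` s] = [set` [fset j in s]%fset]); last first.
  by apply/seteqP; split=> i /=; rewrite mem.
rewrite ind; first by apply: perm_big; apply: uniq_perm; rewrite ?fset_uniq.
  by move=> i /=; rewrite mem; exact: sD.
by move=> i; rewrite mem; exact: FE.
Qed.

Section RealProbability.
Context d (Omega : measurableType d) (R : realType) (P : probability Omega R).

Definition pr (A : set Omega) : R := fine (P A).

Lemma prE A : measurable A -> P A = (pr A)%:E.
Proof. by move=> mA; rewrite /pr fineK// fin_num_measure. Qed.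

Lemma pr_ge0 A : 0 <= pr A.
Proof. exact: fine_ge0. Qed.

Lemma pr_setT : pr setT = 1.
Proof. by rewrite /pr probability_setT. Qed.

Lemma pr_set0 : pr set0 = 0.
Proof. by rewrite /pr measure0. Qed.

Lemma pr_mono A B : measurable A -> measurable B -> A `<=` B -> pr A <= pr B.
Proof.
by move=> mA mB AB; rewrite -lee_fin -!prE// le_measure ?inE.
Qed.

Lemma pr_le1 A : measurable A -> pr A <= 1.
Proof. by move=> mA; rewrite -pr_setT pr_mono. Qed.

Lemma prU A B : measurable A -> measurable B -> pr (A `|` B) <= pr A + pr B.
Proof.
move=> mA mB; rewrite -lee_fin EFinD -!prE//; last exact: measurableU.
exact: measureU2.
Qed.

Lemma prUI A B : measurable A -> measurable B ->
  pr (A `|` B) + pr (A `&` B) = pr A + pr B.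
Proof.
move=> mA mB.
have mU : measurable (A `|` B) by exact: measurableU.
have mI : measurable (A `&` B) by exact: measurableI.
have : P (A `|` B) = (P A + P B - P (A `&` B))%E.
  by apply: measureUfinr => //=; rewrite ltey_eq fin_num_measure.
by rewrite !prE// => -[->]; rewrite subrK.
Qed.

Lemma pr_bigU n (A : nat -> set Omega) : (forall i, measurable (A i)) ->
  pr (\big[setU/set0]_(i < n) A i) <= \sum_(i < n) pr (A i).
Proof.
move=> mA; elim: n => [|n IH]; first by rewrite !big_ord0 pr_set0.
rewrite !big_ord_recr/=; apply: (@le_trans _ _
  (pr (\big[setU/set0]_(i < n) A i) + pr (A n))); last by rewrite lerD2r.
by apply: prU => //; exact: bigsetU_measurable.
Qed.

Lemma prDU A B : measurable A -> measurable B -> A `&` B = set0 ->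
  pr (A `|` B) = pr A + pr B.
Proof. by move=> mA mB AB0; rewrite -prUI// AB0 pr_set0 addr0. Qed.

Lemma pr_slice (A : set Omega) (X : Omega -> nat) (n : nat) :
  measurable A -> (forall i, measurable (X @^-1` [set i])) ->
  (forall w, A w -> (X w < n)%N) ->
  pr A = \sum_(0 <= i < n) pr (A `&` X @^-1` [set i]).
Proof.
move=> mA mX; elim: n A mA => [|n IH] A mA Xn.
  rewrite big_geq// (_ : A = set0) ?pr_set0//.
  by apply/seteqP; split=> // w /Xn.
have mXn : measurable [set w | (X w < n)%N].
  exact: (measurable_rel2 (fun i _ => (i < n)%N) mX mX).
have e : A = (A `&` [set w | (X w < n)%N]) `|` (A `&` X @^-1` [set n]).
  rewrite -setIUr; apply/seteqP; split=> [w Aw|w []//]; split => //.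
  by move: (Xn _ Aw); rewrite ltnS leq_eqVlt => /predU1P[]; [right|left].
rewrite big_nat_recr//= {1}e prDU; last 3 first.
- exact: measurableI.
- exact: measurableI.
- apply/seteqP; split=> // w [[_ /= Xw] [_ /= XE]].
  by move: Xw; rewrite XE ltnn.
congr (_ + _); rewrite IH; last 2 first.
- exact: measurableI.
- by move=> w [].
apply: eq_big_nat => i /andP[_ iltn]; congr pr; apply/seteqP.
split=> [w [[Aw _] Xw]//|w [Aw Xw]]; split => //; split => //=.
by rewrite Xw.
Qed.

(** Z collects the exceptional null set and B the event on which nothing is
    known; elsewhere X' is the disjoint union of X and Y. *)
Lemma pr_update_close (X X' Y B Z : set Omega) :
  measurable X -> measurable X' -> measurable Y -> measurable B ->
  measurable Z -> pr Z = 0 ->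
  (forall w, ~ Z w -> ~ B w -> (X' w <-> X w \/ Y w)) ->
  (forall w, ~ Z w -> X w -> ~ Y w) ->
  `|pr X' - pr X - pr Y| <= pr B.
Proof.
move=> mX mX' mY mB mZ Z0 upd disj.
have mXY : measurable (X `|` Y) by exact: measurableU.
have mBZ : measurable (B `|` Z) by exact: measurableU.
have BZ : pr (B `|` Z) <= pr B by rewrite -[leRHS]addr0 -Z0 prU.
have h1 : pr X' <= pr (X `|` Y) + pr B.
  apply: (@le_trans _ _ (pr ((X `|` Y) `|` (B `|` Z)))).
    apply: pr_mono => //; first exact: measurableU.
    move=> w X'w; have [Zw|nZ] := pselect (Z w); first by right; right.
    have [Bw|nB] := pselect (B w); first by right; left.
    by left; apply/upd.
  by apply: le_trans (prU mXY mBZ) _; rewrite lerD2l.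
have h2 : pr (X `|` Y) <= pr X' + pr B.
  apply: (@le_trans _ _ (pr (X' `|` (B `|` Z)))).
    apply: pr_mono => //; first exact: measurableU.
    move=> w XYw; have [Zw|nZ] := pselect (Z w); first by right; right.
    have [Bw|nB] := pselect (B w); first by right; left.
    by left; apply/upd.
  by apply: le_trans (prU mX' mBZ) _; rewrite lerD2l.
have h3 : pr (X `&` Y) = 0.
  apply/eqP; rewrite eq_le pr_ge0 andbT -Z0 pr_mono//.
    exact: measurableI.
  by move=> w [Xw Yw]; apply: contrapT => /disj/(_ Xw).
have := prUI mX mY; rewrite h3 addr0 => e.
by rewrite ler_norml; apply/andP; split; lra.
Qed.

End RealProbability.

Definition pois {R : realType} (x : R) (k : nat) : R :=
  x ^+ k / k`!%:R * expR (- x).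

Section PoissonFacts.
Context d (Omega : measurableType d) (R : realType) (P : probability Omega R).
Context (N : R -> {RV P >-> nat}) (pN : poisson_process 1 N).

Lemma measurable_count t i : measurable (N t @^-1` [set i]).
Proof. by rewrite -[X in measurable X]setTI; exact: measurable_funP. Qed.

Lemma measurable_incr s t (Q : nat -> Prop) :
  measurable [set w | Q (increment N s t w)].
Proof.
apply: (@measurable_rel2 _ _ (N t) (N s) (fun i j => Q (i - j)%N));
  exact: measurable_count.
Qed.

(** Independence of the three processes is stated for their generated
    sigma-algebras; this puts the events used below into them. *)
Lemma process_event s t (Q : nat -> nat -> Prop) : 0 <= s -> 0 <= t ->
  sigma_algebra_of_process N [set w | Q (N s w) (N t w)].
Proof.
move=> s0 t0; rewrite /sigma_algebra_of_process; set G := (X in <<s X >>).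
have mem u i : 0 <= u -> G (N u @^-1` [set i]).
  move=> u0; exists u => //; exists [set i] => //.
  by rewrite setTI.
by apply: (@measurable_rel2 _ (g_sigma_algebraType G) (N s) (N t));
  move=> i; apply: sub_sigma_algebra; exact: mem.
Qed.

Lemma pr_incr s t k : 0 <= s -> s < t ->
  pr P [set w | increment N s t w = k] = pois (t - s) k.
Proof.
move=> s0 st; rewrite /pr (poisson_increment pN)// mul1r /= /poisson_pmf.
by rewrite subr_gt0 st.
Qed.

Lemma incr0 t w : increment N 0 t w = N t w.
Proof. by rewrite /increment (poisson_at0 pN) subn0. Qed.

Lemma pr_incr_ge1 s t : 0 <= s -> s < t ->
  pr P [set w | (1 <= increment N s t w)%N] <= t - s.
Proof.
move=> s0 st; have m0 := measurable_incr s t (fun k => k = 0%N).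
have m1 := measurable_incr s t (fun k => (1 <= k)%N).
have : pr P ([set w | increment N s t w = 0%N] `|`
    [set w | (1 <= increment N s t w)%N]) <= 1.
  by apply: pr_le1; exact: measurableU.
rewrite prDU//; last first.
  by apply/seteqP; split=> // w [/= ->].
rewrite pr_incr// /pois expr0 fact0 divr1 mul1r.
by have := expR_ge1Dx (- (t - s)); lra.
Qed.

Lemma pr_incr_ge2 s t : 0 <= s -> s < t ->
  pr P [set w | (2 <= increment N s t w)%N] <= (t - s) ^+ 2.
Proof.
move=> s0 st; have m0 := measurable_incr s t (fun k => k = 0%N).
have m1 := measurable_incr s t (fun k => k = 1%N).
have m2 := measurable_incr s t (fun k => (2 <= k)%N).
have m01 := measurableU _ _ m0 m1.
have : pr P (([set w | increment N s t w = 0%N] `|`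
    [set w | increment N s t w = 1%N]) `|`
    [set w | (2 <= increment N s t w)%N]) <= 1.
  by apply: pr_le1; exact: measurableU.
rewrite prDU//; last first.
  by apply/seteqP; split=> // w [/= [->|->]].
rewrite prDU//; last first.
  by apply/seteqP; split=> // w [/= ->].
rewrite !pr_incr// /pois expr0 fact0 mul1r expr1 (factS 0) fact0 muln1 !divr1.
have := expR_ge1Dx (- (t - s)); move: st; rewrite -subr_gt0.
move: (t - s) (expR _) => x e x0 xe; nra.
Qed.

(** N s is the increment over [0, s], so this is independence of two
    consecutive increments. *)
Lemma pr_count_incr s t i k : 0 < s -> s < t ->
  pr P ([set w | N s w = i] `&` [set w | increment N s t w = k]) =
  pois s i * pois (t - s) k.
Proof.
move=> s0 st.
(* Constant from t on: only the increments over [0, s] and (s, t] matter. *)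
pose u (j : nat) : R := if j is j'.+1 then (if j' is 0%N then s else t) else 0.
have umono j : u j <= u j.+1.
  by case: j => [|[|[|j]]] //=; exact: ltW.
have ind := poisson_independent_increments pN (lexx 0 : 0 <= u 0%N) umono.
pose E := fun j : nat =>
  if j is 0%N then [set w | N s w = i]
  else [set w | increment N s t w = k].
have := @independent_seq _ _ _ P _ _ _ [:: 0%N; 1%N] E ind.
rewrite (_ : \bigcap_(_ in _) _ =
  [set w | N s w = i] `&` [set w | increment N s t w = k]); last first.
  apply/seteqP; split=> [w h|w [h0 h1] j /=].
    by split; [apply: (h 0%N)|apply: (h 1%N)].
  by rewrite !inE => /orP[]/eqP->.
rewrite !big_cons big_nil mule1 /pr => ->//; rewrite /E.
- rewrite (_ : [set w | N s w = i] =
      [set w | increment N 0 s w = i]); last first.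
    by apply/seteqP; split=> w /=; rewrite incr0.
  rewrite (poisson_increment pN)// (poisson_increment pN) ?ltW//.
  by rewrite /= /poisson_pmf subr0 !mul1r subr_gt0 st s0.
- move=> j; rewrite !inE => /orP[]/eqP->.
    exists [set i] => //; rewrite setTI.
    by apply/seteqP; split=> w /=; rewrite incr0.
  by exists [set k] => //; rewrite setTI.
Qed.

End PoissonFacts.

(** * The occupation probability over a short time interval *)

(** The mass at h of the height when the three counts are independent Poisson
    variables of parameter s; k is the maximum of the two side counts. *)
Definition height_pmf {R : realType} (h : nat) (s : R) : R :=
  \sum_(0 <= k < h.+1) pois s (h - k) *
    (pois s k ^+ 2 + 2 * pois s k * \sum_(0 <= j < k) pois s j).

(** The law of the maximum of two independent variables with common weights p:
    either both are equal to k or exactly one of them is. *)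
Lemma sum_max {R : comPzRingType} (p : nat -> R) (k : nat) :
  \sum_(0 <= j < k.+1) \sum_(0 <= l < k.+1)
    (if maxn j l == k then p j * p l else 0) =
  p k ^+ 2 + 2 * p k * \sum_(0 <= j < k) p j.
Proof.
rewrite big_nat_recr//= (eq_big_nat _ _ (F2 := fun j => p k * p j)); last first.
  move=> j /andP[_ jk]; rewrite big_nat_recr//= big1_seq ?add0r.
    by rewrite (maxn_idPr (ltnW jk)) eqxx mulrC.
  move=> l; rewrite mem_index_iota => /andP[_ /andP[_ lk]].
  by rewrite ifF//; apply/negbTE; lia.
rewrite [X in _ + X](eq_big_nat _ _ (F2 := fun j => p k * p j)); last first.
  by move=> l /andP[_ lk]; rewrite (maxn_idPl _)// eqxx.
rewrite big_nat_recr//= -mulr_sumr; ring.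
Qed.

Section System.
Context (R : realType) d (Omega : measurableType d) (P : probability Omega R).
Context (N : int -> R -> {RV P >-> nat})
  (kappa : R -> int -> nat -> {RV P >-> bool})
  (park : parking_system N kappa).

Let pN x : x \in arrival_positions -> poisson_process 1 (N x).
Proof. exact: (arrivals_poisson park). Qed.

Let pNc : poisson_process 1 (N 0). Proof. exact: pN. Qed.

Lemma counting_arrivals w : counting_paths (fun x t => N x t w).
Proof.
have split_pos x : x \in positions ->
    x \in arrival_positions \/ x \in [:: -2; 2 : int].
  rewrite !inE => /or4P[|||/orP[]]->; rewrite ?orbT; by [left|right].
have bd x t : x \in [:: -2; 2 : int] -> 0 <= t -> N x t w = 0%N.
  exact: (no_boundary_arrivals park).
split=> //.
- move=> x /split_pos[xa|xb]; first exact: (poisson_at0 (pN xa)).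
  exact: bd.
- move=> x s t /split_pos[xa|xb] s0 st.
    exact: (poisson_nondecreasing (pN xa)).
  by rewrite !bd// (le_trans s0).
- move=> x t /split_pos[xa|xb] t0.
    exact: (poisson_right_continuous (pN xa)).
  near=> s; rewrite !bd//; apply: (le_trans t0); apply: ltW.
  by near: s; exact: nbhs_right_gt.
Unshelve. all: by end_near. Qed.

Lemma pr_independent3 (A B C : set Omega) :
  sigma_algebra_of_process (N (-1)) A -> sigma_algebra_of_process (N 0) B ->
  sigma_algebra_of_process (N 1) C ->
  pr P (A `&` B `&` C) = pr P A * pr P B * pr P C.
Proof.
move=> sA sB sC; pose E (x : int) : set Omega :=
  if x == -1 then A else if x == 0 then B else C.
have mem x : x \in arrival_positions -> sigma_algebra_of_process (N x) (E x).
  by rewrite !inE => /or3P[]/eqP->.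
have := independent_seq (arrivals_independent park) (s := arrival_positions)
  (E := E) erefl (fun _ h => h) mem.
have mS x D : x \in arrival_positions ->
    sigma_algebra_of_process (N x) D -> measurable D.
  move=> xa; apply: smallest_sub; first exact: sigma_algebra_measurable.
  move=> _ [t _ [Y mY <-]]; rewrite setTI -[X in measurable X]setTI.
  exact: measurable_funP.
have -> : \bigcap_(i in [set` arrival_positions]) E i = A `&` B `&` C.
  apply/seteqP; split=> [w h|w [[Aw Bw] Cw] x /=].
    by split; [split; [exact: (h (-1))|exact: (h 0)]|exact: (h 1)].
  by rewrite !inE => /or3P[]/eqP->.
rewrite !big_cons big_nil mule1 /E/= => e.
have mA := mS (-1) A erefl sA; have mB := mS 0 B erefl sB.
have mC := mS 1 C erefl sC.
rewrite {1}/pr e (prE P mA) (prE P mB) (prE P mC) -!EFinM/=; ring.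
Qed.

Definition active x s t : set Omega :=
  [set w | (1 <= increment (N x) s t w)%N].

Definition active_twice x s t : set Omega :=
  [set w | (2 <= increment (N x) s t w)%N].

(** A union of six events that contains the event of two or more arrivals in
    (s, t] and whose probability is bounded term by term. *)
Definition busy (s t : R) : set Omega :=
  active_twice (-1) s t `|` active_twice 0 s t `|` active_twice 1 s t `|`
  active (-1) s t `&` active 0 s t `|` active (-1) s t `&` active 1 s t `|`
  active 0 s t `&` active 1 s t.

Let measurable_active x s t : measurable (active x s t).
Proof. exact: (measurable_incr (N x) s t (fun k => (1 <= k)%N)). Qed.

Let measurable_active_twice x s t : measurable (active_twice x s t).
Proof. exact: (measurable_incr (N x) s t (fun k => (2 <= k)%N)). Qed.

Lemma measurable_busy s t : measurable (busy s t).
Proof.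
by repeat (apply: measurableU || apply: measurableI) => //.
Qed.

Lemma not_busy s t w : ~ busy s t w ->
  (total_count (fun x t => N x t w) t <=
   (total_count (fun x t => N x t w) s).+1)%N.
Proof.
apply: contra_notT; rewrite -ltnNge /total_count /busy /active_twice /active /=.
rewrite /increment.
move: (N (-1) t w) (N (-1) s w) (N 0 t w) (N 0 s w) (N 1 t w) (N 1 s w).
move=> a a' b b' c c' h.
have [|h1] := leqP 2 (a - a'); first by do 5 left.
have [|h2] := leqP 2 (b - b'); first by do 4 left; right.
have [|h3] := leqP 2 (c - c'); first by do 3 left; right.
have [h4|h4] := leqP 1 (a - a'); have [h5|h5] := leqP 1 (b - b');
  have [h6|h6] := leqP 1 (c - c');
  [do 2 left; right|do 2 left; right|left; right| |right|..];
  rewrite //; exfalso; lia.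
Qed.

Lemma process_active x s t : 0 <= s -> s < t ->
  sigma_algebra_of_process (N x) (active x s t).
Proof.
move=> s0 st; apply: (process_event (fun i j => (1 <= j - i)%N)) => //.
exact: le_trans (ltW st).
Qed.

Lemma process_setT x : sigma_algebra_of_process (N x) setT.
Proof.
have := process_event (N := N x) (fun _ _ => True) (lexx 0) (lexx 0).
by congr (sigma_algebra_of_process _ _); apply/seteqP; split.
Qed.

Lemma pr_busy s t : 0 <= s -> s < t -> pr P (busy s t) <= 6 * (t - s) ^+ 2.
Proof.
move=> s0 st.
have two x : x \in arrival_positions ->
    pr P (active_twice x s t) <= (t - s) ^+ 2.
  by move=> /pN pNx; exact: pr_incr_ge2.
have one x : x \in arrival_positions -> pr P (active x s t) <= t - s.
  by move=> /pN pNx; exact: pr_incr_ge1.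
have sig x := process_active (x := x) s0 st.
have prod x y : pr P (active x s t) <= t - s -> pr P (active y s t) <= t - s ->
    pr P (active x s t) * pr P (active y s t) <= (t - s) ^+ 2.
  by move=> hx hy; rewrite expr2 ler_pM ?pr_ge0.
have b1 := two (-1) erefl; have b2 := two 0 erefl; have b3 := two 1 erefl.
have b4 : pr P (active (-1) s t `&` active 0 s t) <= (t - s) ^+ 2.
  have := pr_independent3 (sig (-1)) (sig 0) (@process_setT 1).
  by rewrite setIT pr_setT mulr1 => ->; apply: prod; exact: one.
have b5 : pr P (active (-1) s t `&` active 1 s t) <= (t - s) ^+ 2.
  have := pr_independent3 (sig (-1)) (@process_setT 0) (sig 1).
  by rewrite setIT pr_setT mulr1 => ->; apply: prod; exact: one.
have b6 : pr P (active 0 s t `&` active 1 s t) <= (t - s) ^+ 2.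
  have := pr_independent3 (@process_setT (-1)) (sig 0) (sig 1).
  by rewrite setTI pr_setT mul1r => ->; apply: prod; exact: one.
have prU_le A B x y : measurable A -> measurable B -> pr P A <= x ->
    pr P B <= y -> pr P (A `|` B) <= x + y.
  by move=> mA mB Ax By; apply: le_trans (prU P mA mB) _; exact: lerD.
rewrite (_ : 6 * _ = (t - s) ^+ 2 + (t - s) ^+ 2 + (t - s) ^+ 2 +
  (t - s) ^+ 2 + (t - s) ^+ 2 + (t - s) ^+ 2); last by ring.
do 5 (apply: (prU_le);
  [by repeat (apply: measurableU || apply: measurableI) => //
  |by repeat (apply: measurableU || apply: measurableI) => // | |by []]).
exact: b1.
Qed.

Definition parks_along w :=
  parking_path (fun x t => N x t w) (fun t x r => kappa t x r w).

Lemma stacked_mesh w (m : nat) (u : nat -> R) : parks_along w -> u 0%N = 0 ->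
  (forall i, u i <= u i.+1) ->
  (forall i, (i < m)%N -> ~ busy (u i) (u i.+1) w) ->
  stacked (fun x r => kappa (u m) x r w) (fun x => N x (u m) w).
Proof.
move=> ok u0 umono; have u_ge0 i : 0 <= u i.
  by elim: i => [|i]; rewrite ?u0// => /le_trans; apply.
elim: m => [|m IH] nb.
  have st0 : stacked (fun x r => kappa 0 x r w) (fun=> 0%N).
    by apply: stacked_init => x r; exact: (initially_empty ok).
  rewrite u0; apply: stacked_eq st0 _ _ => // x xa.
  exact: (poisson_at0 (pN xa)).
have := path_step (counting_arrivals w) ok (u_ge0 m) (umono m).
move=> /(_ (not_busy (nb _ (ltnSn m))) (IH _))[]// i im.
by apply: nb; exact: ltnW.
Qed.

(** Simultaneous arrivals could destroy the invariant, but they make some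
    interval of every mesh of [0, a] busy. The mesh with m + 1 intervals has a
    busy one with probability at most 6 a ^ 2 / (m + 1), so almost surely some
    mesh has none, and [stacked_mesh] applies to it. *)
Lemma stacked_ae a : 0 < a -> exists Z : set Omega,
  [/\ measurable Z, pr P Z = 0 & forall w, ~ Z w ->
    parks_along w /\ stacked (fun x r => kappa a x r w) (fun x => N x a w)].
Proof.
move=> a0; have [Z0 [mZ0 PZ0 subZ0]] := parking_dynamics park.
pose u m i : R := a * (i%:R / m.+1%:R).
pose bad m := \big[setU/set0]_(i < m.+1) busy (u m i) (u m i.+1).
have mbad m : measurable (bad m).
  by apply: bigsetU_measurable => i _; exact: measurable_busy.
have mcap : measurable (\bigcap_m bad m) by exact: bigcap_measurable.
have du m i : u m i.+1 - u m i = a / m.+1%:R.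
  by rewrite /u -natr1; ring.
have u_ge0 m i : 0 <= u m i.
  by rewrite /u mulr_ge0 ?divr_ge0// ltW.
have pbad m : pr P (bad m) <= 6 * a ^+ 2 / m.+1%:R.
  apply: le_trans (pr_bigU P _ (fun i => measurable_busy (u m i) (u m i.+1))) _.
  apply: (@le_trans _ _ (\sum_(i < m.+1) 6 * (a / m.+1%:R) ^+ 2)).
    apply: ler_sum => i _; rewrite -(du m i); apply: pr_busy => //.
    by rewrite -subr_gt0 du divr_gt0.
  rewrite sumr_const card_ord -mulr_natl le_eqVlt; apply/orP; left.
  by apply/eqP; field; rewrite addrC natr1 pnatr_eq0.
have pcap : pr P (\bigcap_m bad m) = 0.
  apply/eqP; rewrite eq_le pr_ge0 andbT leNgt; apply/negP => e0.
  set e := pr P _ in e0.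
  have q0 : 0 <= 6 * a ^+ 2 / e by rewrite divr_ge0 ?mulr_ge0 ?exprn_ge0 ?ltW.
  have := archi_boundP q0; set m := Num.bound _ => mq.
  have : e <= 6 * a ^+ 2 / m.+1%:R.
    by apply: le_trans (pbad m); apply: pr_mono => // w; exact.
  apply/negP; rewrite -ltNge ltr_pdivrMr// [e * _]mulrC -ltr_pdivrMr//.
  by apply: lt_trans mq _; rewrite ltr_nat.
exists (Z0 `|` \bigcap_m bad m); split.
- exact: measurableU.
- apply/eqP; rewrite eq_le pr_ge0 andbT; apply: le_trans (prU P mZ0 mcap) _.
  by rewrite pcap addr0 /pr PZ0.
- move=> w nZ.
  have ok : parks_along w.
    by apply: contrapT => nok; apply: nZ; left; exact: subZ0.
  split=> //.
  have [m nb] : exists m, ~ bad m w.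
    by apply: contrapT => nex; apply: nZ; right => m _;
      apply: contrapT => nb; apply: nex; exists m.
  have -> : a = u m m.+1 by rewrite /u divff ?mulr1.
  apply: stacked_mesh => //.
  + by rewrite /u mul0r mulr0.
  + by move=> i; rewrite -subr_ge0 du divr_ge0// ltW.
  + move=> i im bi; apply: nb; rewrite /bad.
    by rewrite -(bigcup_mkord _ (fun i => busy (u m i) (u m i.+1))); exists i.
Qed.

Lemma measurable_occupied s x r : measurable [set w | kappa s x r w].
Proof.
rewrite (_ : [set w | _] = kappa s x r @^-1` [set true])//.
by rewrite -[X in measurable X]setTI; exact: measurable_funP.
Qed.

Definition occupation h s : R := pr P [set w | kappa s 0 h.+1 w].

Lemma density_occupation h s : density kappa s 0 h.+1 = (occupation h s)%:E.
Proof.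
rewrite /density /occupation -prE; last exact: measurable_occupied.
rewrite -(expectation_indic P (measurable_occupied s 0 h.+1)).
by congr expectation; apply/funext => w; rewrite indicE; congr (_%:R);
  congr nat_of_bool; apply/idP/idP; rewrite inE.
Qed.

(** Up to an event of probability O((b - a) ^ 2) this is the event that site
    (0, h + 1) gets occupied during (a, b]. *)
Definition center_hit h a b : set Omega :=
  [set w | height (fun x => N x a w) = h /\ increment (N 0) a b w = 1%N].

Lemma pr_counts_incr a b i j l : 0 < a -> a < b ->
  pr P ([set w | N (-1) a w = j] `&`
    ([set w | N 0 a w = i] `&` [set w | increment (N 0) a b w = 1%N]) `&`
    [set w | N 1 a w = l]) =
  pois a j * (pois a i * pois (b - a) 1) * pois a l.
Proof.
move=> a0 ab; have ge0 := ltW a0; have bge0 := le_trans ge0 (ltW ab).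
have pC x k : x \in arrival_positions ->
    pr P [set w | N x a w = k] = pois a k.
  move=> /pN pNx; rewrite -[in RHS](subr0 a) -(pr_incr pNx)//.
  by congr pr; apply/seteqP; split=> w /=; rewrite (incr0 pNx).
rewrite pr_independent3 ?pC// ?(pr_count_incr pNc)//.
- exact: (process_event (fun p _ => p = j) ge0 ge0).
- exact: (process_event (fun p q => p = i /\ (q - p)%N = 1%N) ge0 bge0).
- exact: (process_event (fun p _ => p = l) ge0 ge0).
Qed.

Lemma measurable_center_hit h a b : measurable (center_hit h a b).
Proof.
rewrite (_ : center_hit h a b = \bigcup_i \bigcup_j \bigcup_l
  (if (i + maxn j l == h)%N then [set w | N (-1) a w = j] `&`
    ([set w | N 0 a w = i] `&` [set w | increment (N 0) a b w = 1%N]) `&`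
    [set w | N 1 a w = l] else set0)).
  do 3 apply: bigcup_measurable => ? _; case: ifP => // _.
  apply: measurableI; last exact: measurable_count.
  apply: measurableI; first exact: measurable_count.
  apply: measurableI; first exact: measurable_count.
  exact: (measurable_incr (N 0) a b (fun k => k = 1%N)).
apply/seteqP; split=> [w [/= hh inc]|w].
  exists (N 0 a w) => //; exists (N (-1) a w) => //; exists (N 1 a w) => //.
  by rewrite ifT//; apply/eqP.
move=> [i _ [j _ [l _]]]; case: ifP => // /eqP hh [[/= ej [ei inc]] el].
by split=> //; rewrite /height ei ej el.
Qed.

(** The event is sliced along the three counts at time a; the weights of the
    slices are given by independence and summed by [sum_max]. *)
Lemma pr_center_hit h a b : 0 < a -> a < b ->
  pr P (center_hit h a b) = pois (b - a) 1 * height_pmf h a.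
Proof.
move=> a0 ab; have mR := measurable_center_hit h a b.
have mN x i : measurable (N x a @^-1` [set i]) by exact: measurable_count.
rewrite (pr_slice P (X := N 0 a) (n := h.+1))//; last first.
  by move=> w [/= + _]; rewrite /height; move: (N 0 a w) (maxn _ _); lia.
(* N 0 a = h - k is reindexed by the maximum k of the side counts. *)
rewrite big_nat_rev/= /height_pmf mulr_sumr; apply: eq_big_nat => k /andP[_ kh].
rewrite add0n subSS -sum_max mulrA mulr_sumr.
have mR0 := measurableI _ _ mR (mN 0 (h - k)%N).
have bound w : (center_hit h a b `&` N 0 a @^-1` [set (h - k)%N]) w ->
    maxn (N (-1) a w) (N 1 a w) = k.
  move=> [[/= hh _] /= e0]; move: hh kh; rewrite /height e0.
  by move: (maxn _ _); lia.
rewrite (pr_slice P (X := N (-1) a) (n := k.+1))//; last first.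
  by move=> w /bound <-; rewrite ltnS leq_maxl.
apply: eq_big_nat => j _; rewrite mulr_sumr.
rewrite (pr_slice P (X := N 1 a) (n := k.+1))//; last 2 first.
- exact: measurableI.
- by move=> w [/bound <- _]; rewrite ltnS leq_maxr.
apply: eq_big_nat => l _; case: ifP => [/eqP jlk|jlk]; last first.
  rewrite mulr0 -[RHS](pr_set0 P); congr pr; apply/seteqP; split=> // w.
  by move=> [[/bound + /= ej] /= el]; rewrite ej el => /eqP; rewrite jlk.
rewrite (_ : _ `&` _ = [set w | N (-1) a w = j] `&`
    ([set w | N 0 a w = (h - k)%N] `&`
      [set w | increment (N 0) a b w = 1%N]) `&` [set w | N 1 a w = l]).
  by rewrite pr_counts_incr//; ring.
apply/seteqP; split=> w /=.
  by move=> [[[[/= _ inc] ei] ej] el].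
move=> [[ej [ei inc]] el]; split=> //; split=> //; split=> //; split=> //=.
by rewrite /height ei ej el jlk subnK.
Qed.

(** Off the busy event the site is filled exactly on [center_hit]; the two cases
    exclude each other since layer H + 1 is empty when H layers are nonempty. *)
Lemma occupation_step h a b : 0 < a -> a < b ->
  `|occupation h b - occupation h a - pois (b - a) 1 * height_pmf h a|
    <= 6 * (b - a) ^+ 2.
Proof.
move=> a0 ab; rewrite -pr_center_hit//.
have [Z [mZ PZ okZ]] := stacked_ae a0.
apply: le_trans (pr_busy (ltW a0) ab).
apply: pr_update_close PZ _ _ => //.
- exact: measurable_occupied.
- exact: measurable_occupied.
- exact: measurable_center_hit.
- exact: measurable_busy.
- move=> w /okZ[ok st] nb.
  have [_ /(_ h) /= e] := path_step (counting_arrivals w) ok (ltW a0) (ltW ab)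
    (not_busy nb) st.
  rewrite /= e; split=> [/orP[->|/andP[/eqP n0 /eqP hh]]|[->//|[hh /= inc]]].
  + by left.
  + by right; split=> //=; rewrite /increment n0 subSnn.
  + rewrite hh eqxx andbT (_ : N 0 b w = (N 0 a w).+1) ?eqxx ?orbT//.
    by move: inc; rewrite /increment; lia.
- move=> w /okZ[_ st] /= occ [hh _].
  by move: (stacked_top_vacant st); rewrite hh occ.
Qed.

(** Without any arrival in (0, b] the configuration is still empty. *)
Lemma occupation_le h b : 0 <= b -> occupation h b <= 3 * b.
Proof.
move=> b0; have [Z [mZ PZ subZ]] := parking_dynamics park.
have one x : x \in arrival_positions -> pr P (active x 0 b) <= b.
  move=> /pN pNx; move: b0; rewrite le_eqVlt => /predU1P[<-|b0].
    rewrite (_ : active x 0 0 = set0) ?pr_set0//; apply/seteqP; split=> // w.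
    by rewrite /active/= /increment subnn.
  by rewrite -[leRHS]subr0; exact: pr_incr_ge1.
have mA x : measurable (active x 0 b) by exact: measurable_active.
have m2 : measurable (active (-1) 0 b `|` active 0 0 b) by exact: measurableU.
have m3 : measurable (active (-1) 0 b `|` active 0 0 b `|` active 1 0 b).
  exact: measurableU.
apply: (@le_trans _ _ (pr P (active (-1) 0 b `|` active 0 0 b `|` active 1 0 b
  `|` Z))).
  apply: pr_mono; [exact: measurable_occupied|exact: measurableU|].
  move=> w /= occ; apply: contrapT => no.
  have ok : parks_along w.
    by apply: contrapT => nok; apply: no; right; exact: subZ.
  have idle x : x \in arrival_positions -> ~ active x 0 b w ->
      N x 0 w = N x b w.
    move=> /pN pNx; rewrite /active/= (incr0 pNx) (poisson_at0 pNx).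
    by case: (N x b w).
  have same x : x \in positions -> N x 0 w = N x b w.
    have bd := no_boundary_arrivals park.
    rewrite !inE => /or4P[|||/orP[]] /eqP->; first [by rewrite !bd|
      apply: idle => // act; apply: no; left].
    - by left; left.
    - by left; right.
    - by right.
  move: occ; rewrite (no_arrival ok (lexx 0) b0 same)//.
  by apply/negP; exact: (initially_empty ok).
apply: le_trans (prU P m3 mZ) _.
apply: le_trans (lerD (prU P m2 (mA 1)) (lexx _)) _.
apply: le_trans (lerD (lerD (prU P (mA (-1)) (mA 0)) (lexx _)) (lexx _)) _.
have := one (-1) erefl; have := one 0 erefl; have := one 1 erefl.
rewrite [pr P Z]/pr PZ /=; lra.
Qed.

End System.

(** * Integrating the rate of center deposits *)

Section Analysis.
Context {R : realType}.

(** The distribution function of the sum of n + 1 independent exponential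
    variables of rate 3, that is 3 ^ (n + 1) / n! times the integral of
    x ^ n e ^ (- 3 x) over [0, s]. *)
Definition erlang (n : nat) (s : R) : R :=
  1 - (\sum_(0 <= i < n.+1) (3 * s) ^+ i / i`!%:R) * expR (- (3 * s)).

Lemma erlang0 n : erlang n 0 = 0.
Proof.
rewrite /erlang mulr0 oppr0 expR0 mulr1 big_nat_recl// expr0 fact0 divr1.
by rewrite big1 ?addr0 ?subrr// => i _; rewrite expr0n mul0r.
Qed.

Lemma is_derive_erlang n (s : R) :
  is_derive s 1 (erlang n) (3 * ((3 * s) ^+ n / n`!%:R * expR (- (3 * s)))).
Proof.
elim: n => [|n IH].
  have -> : erlang 0 = (fun s => 1 - expR (- (3 * s))).
    by apply/funext => x; rewrite /erlang big_nat1 expr0 fact0 divr1 mul1r.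
  by apply: is_derive_eq; rewrite expr0 fact0 /GRing.scale/=; field.
have -> : erlang n.+1 = (fun s => erlang n s -
    (3 * s) ^+ n.+1 / n.+1`!%:R * expR (- (3 * s))).
  by apply/funext => x; rewrite /erlang big_nat_recr//=; ring.
have d1 : is_derive s 1 (fun x : R => 3 * x) 3.
  by apply: is_derive_eq; rewrite /GRing.scale/= mulr1.
have dX : is_derive s 1 (fun x : R => (3 * x) ^+ n.+1)
    (n.+1%:R * (3 * s) ^+ n * 3).
  have -> : (fun x : R => (3 * x) ^+ n.+1) = (fun x : R => 3 * x) ^+ n.+1.
    by apply/funext => x; rewrite exprfctE.
  exact: (is_deriveX n.+1 d1).
have de : is_derive s 1 (fun x : R => expR (- (3 * x)))
    (expR (- (3 * s)) * -3).
  by apply: is_derive_eq; rewrite /GRing.scale/=; ring.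
have dc : is_derive s 1 (fun _ : R => n.+1`!%:R^-1 : R) 0.
  exact: is_derive_cst.
have dt := is_deriveM (is_deriveM dX dc) de.
apply: is_derive_eq (is_deriveB IH dt) _.
rewrite /GRing.scale/= mulrfctE /= factS natrM exprS.
have f0 : n`!%:R != 0 :> R by rewrite pnatr_eq0 -lt0n fact_gt0.
have n0 : n.+1%:R != 0 :> R by rewrite pnatr_eq0.
by field; rewrite f0 addrC natr1.
Qed.

Lemma is_derive_big_nat n (F dF : nat -> R -> R) (s : R) :
  (forall k, is_derive s 1 (F k) (dF k s)) ->
  is_derive s 1 (fun x => \sum_(0 <= k < n) F k x)
    (\sum_(0 <= k < n) dF k s).
Proof.
move=> dFk; elim: n => [|n IH].
  under eq_fun do rewrite big_geq//.
  by rewrite big_geq//; exact: is_derive_cst.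
under eq_fun do rewrite big_nat_recr//=.
by rewrite big_nat_recr//=; exact: is_deriveD.
Qed.

Lemma is_derive_scale (c : R) (F : R -> R) (s dF : R) :
  is_derive s 1 F dF -> is_derive s 1 (fun x => c * F x) (c * dF).
Proof. exact: is_deriveZ. Qed.

Definition layer_density (h : nat) (s : R) : R :=
  \sum_(0 <= k < h.+1)
    ('C(h, k)%:R * 'C(h + k, k)%:R * (1 / 3) ^+ (h + k).+1 * erlang (h + k) s
     + 2 * 'C(h, k)%:R * \sum_(0 <= j < k)
         'C(h + j, j)%:R * (1 / 3) ^+ (h + j).+1 * erlang (h + j) s).

Lemma layer_densityE h t : layer_density h t =
  \sum_(0 <= k < h.+1)
      ('C(h, k)%:R * 'C(h + k, k)%:R * (1 / 3) ^+ (h + k).+1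
       + 2 * 'C(h, k)%:R *
         \sum_(0 <= j < k) 'C(h + j, j)%:R * (1 / 3) ^+ (h + j).+1)
   - (\sum_(0 <= k < h.+1)
      ('C(h, k)%:R * 'C(h + k, k)%:R * (1 / 3) ^+ (h + k).+1 *
         (\sum_(0 <= i < (h + k).+1) (3 * t) ^+ i / i`!%:R)
       + 2 * 'C(h, k)%:R *
         \sum_(0 <= j < k) ('C(h + j, j)%:R * (1 / 3) ^+ (h + j).+1 *
           \sum_(0 <= i < (h + j).+1) (3 * t) ^+ i / i`!%:R)))
     * expR (- (3 * t)).
Proof.
rewrite mulr_suml -sumrB; apply: eq_bigr => k _.
rewrite (eq_bigr (fun j => 'C(h + j, j)%:R * (1 / 3) ^+ (h + j).+1 -
  'C(h + j, j)%:R * (1 / 3) ^+ (h + j).+1 *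
  (\sum_(0 <= i < (h + j).+1) (3 * t) ^+ i / i`!%:R) * expR (- (3 * t)))).
  by rewrite sumrB -mulr_suml /erlang; ring.
by move=> j _; rewrite /erlang; ring.
Qed.

Lemma layer_density0 h : layer_density h 0 = 0.
Proof.
rewrite /layer_density big1// => k _; rewrite erlang0 mulr0 add0r.
by rewrite big1 ?mulr0// => j _; rewrite erlang0 mulr0.
Qed.

(** Both sides equal s ^ (h + j) e ^ (- 3 s) / ((h - k)! k! j!); on the left,
    (h + j)! cancels against the binomial coefficients. *)
Lemma pois_product (h k j : nat) (s : R) : (k <= h)%N ->
  'C(h, k)%:R * 'C(h + j, j)%:R * (1 / 3) ^+ (h + j).+1 *
    (3 * ((3 * s) ^+ (h + j) / (h + j)`!%:R * expR (- (3 * s)))) =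
  pois s (h - k) * pois s k * pois s j.
Proof.
move=> kh; have fE n : n`!%:R != 0 :> R by rewrite pnatr_eq0 -lt0n fact_gt0.
have bk : 'C(h, k)%:R = h`!%:R / (k`!%:R * (h - k)`!%:R) :> R.
  by rewrite -(bin_fact kh) !natrM; field; rewrite !fE.
have bj : 'C(h + j, j)%:R = (h + j)`!%:R / (j`!%:R * h`!%:R) :> R.
  by rewrite -(bin_fact (leq_addl h j)) addnK !natrM; field; rewrite !fE.
have sE : s ^+ (h + j) = s ^+ (h - k) * s ^+ k * s ^+ j.
  by rewrite -!exprD subnK.
have eE : expR (- (3 * s)) = expR (- s) * expR (- s) * expR (- s).
  by rewrite -!expRD; congr expR; ring.
have t0 : 3 ^+ (h + j) != 0 :> R by rewrite expf_neq0// pnatr_eq0.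
have tE : (1 / 3) ^+ (h + j) = (3 ^+ (h + j))^-1 :> R.
  by rewrite div1r exprVn.
rewrite bk bj eE /pois exprS [(3 * s) ^+ _]exprMn sE tE.
by field; rewrite !fE t0.
Qed.

Lemma is_derive_layer_density h (s : R) :
  is_derive s 1 (layer_density h) (height_pmf h s).
Proof.
pose c k := 'C(h, k)%:R * 'C(h + k, k)%:R * (1 / 3) ^+ (h + k).+1 : R.
pose q k := 3 * ((3 * s) ^+ (h + k) / (h + k)`!%:R * expR (- (3 * s))).
have := @is_derive_big_nat h.+1 (fun k x => c k * erlang (h + k) x +
    2 * 'C(h, k)%:R * \sum_(0 <= j < k)
         'C(h + j, j)%:R * (1 / 3) ^+ (h + j).+1 * erlang (h + j) x)
  (fun k x => c k * q k + 2 * 'C(h, k)%:R * \sum_(0 <= j < k)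
         'C(h + j, j)%:R * (1 / 3) ^+ (h + j).+1 * q j) s.
move=> /(_ _)/is_derive_eq; apply.
  move=> k; apply: is_deriveD.
    by apply: is_derive_scale; exact: is_derive_erlang.
  apply: is_derive_scale; apply: is_derive_big_nat => j.
  by apply: is_derive_scale; exact: is_derive_erlang.
apply: eq_big_nat => k /andP[_ kh]; rewrite mulrDr; congr (_ + _).
  by rewrite /c /q pois_product// expr2 mulrA.
rewrite !mulr_sumr; apply: eq_bigr => j _.
transitivity (2 * (pois s (h - k) * pois s k * pois s j)); last by ring.
by rewrite -pois_product// /q; ring.
Qed.

(** The hypothesis only controls the increment by the value of g at the left
    end point. It gives the right derivative at once; for the left derivative
    the left end point moves, and continuity of g is used. *)
Lemma is_derive_forward_estimate (f g : R -> R) (x : R) (K : R) :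
  (forall a b, 0 < a -> a < b ->
    `|f b - f a - (b - a) * expR (- (b - a)) * g a| <= K * (b - a) ^+ 2) ->
  {for x, continuous g} -> 0 < x -> is_derive x 1 f (g x).
Proof.
move=> fg gx x0.
(* x + (e - |e|) / 2 is the left end point of the interval between x and x + e,
   so psi treats both signs of e together. *)
pose psi (e : R) := expR (- `|e|) * g (x + (e - `|e|) / 2).
have psi_cvg : psi e @[e --> 0^'] --> g x.
  apply: cvg_within_filter.
  have -> : g x = expR (- `|0 : R|) * g (x + (0 - `|0 : R|) / 2).
    by rewrite normr0 subr0 oppr0 expR0 mul1r mul0r addr0.
  apply: cvgM.
    apply: continuous_cvg; first exact: continuous_expR.
    by apply: cvgN; apply: cvg_norm; exact: cvg_id.
  apply: continuous_cvg; first by rewrite normr0 subr0 mul0r addr0.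
  apply: cvgD; first exact: cvg_cst.
  apply: cvgM; last exact: cvg_cst.
  by apply: cvgB; [exact: cvg_id|apply: cvg_norm; exact: cvg_id].
have quot e : e != 0 -> `|e| < x ->
    `|e^-1 * (f (x + e) - f x) - psi e| <= `|K| * `|e|.
  move=> e0 ex; have ne0 : 0 < `|e| by rewrite normr_gt0.
  rewrite -(ler_pM2l ne0) -normrM.
  apply: (@le_trans _ _ (K * `|e| ^+ 2)); last first.
    rewrite [leRHS](_ : _ = `|K| * `|e| ^+ 2); last by ring.
    by rewrite ler_wpM2r// ?exprn_ge0// ler_norm.
  have [ep|en] := ltP 0 e.
    have := fg x (x + e) x0 (ltac:(by rewrite ltrDl)).
    have -> : x + e - x = e by ring.
    rewrite /psi (gtr0_norm ep) subrr mul0r addr0.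
    congr (`|_| <= _); field; exact: e0.
  have en' : e < 0 by rewrite lt_neqAle e0.
  move: ex; rewrite /psi (ltr0_norm en') => ex.
  have := fg (x + e) x (ltac:(lra)) (ltac:(lra)).
  have -> : x - (x + e) = - e by ring.
  have -> : x + (e - - e) / 2 = x + e by field.
  rewrite -[X in X <= _ -> _]normrN.
  congr (`|_| <= _); field; exact: e0.
have lim : e^-1 *: (f (e *: 1 + x) - f x) @[e --> 0^'] --> g x.
  apply/cvgrPdist_le => eps eps0.
  have eps2 : 0 < eps / 2 by rewrite divr_gt0.
  have K0 : 0 < 2 * (`|K| + 1) by rewrite mulr_gt0// ltr_wpDl.
  move/cvgrPdist_le: psi_cvg => /(_ (eps / 2) eps2) psin.
  near=> e.
  have e0 : e != 0 by near: e; exact: nbhs_dnbhs_neq.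
  have ex : `|e| < x by near: e; exact: dnbhs0_lt.
  have eK : `|e| <= eps / (2 * (`|K| + 1)).
    by near: e; apply: dnbhs0_le; exact: divr_gt0.
  have pe : `|g x - psi e| <= eps / 2 by near: e.
  have Ke : `|K| * `|e| <= eps / 2.
    apply: (@le_trans _ _ ((`|K| + 1) * (eps / (2 * (`|K| + 1))))).
      by apply: ler_pM => //; rewrite lerDl.
    by rewrite le_eqVlt; apply/orP; left; apply/eqP; field; lra.
  rewrite scaler1 [e + x]addrC.
  have -> : g x - e^-1 *: (f (x + e) - f x) =
      (g x - psi e) - (e^-1 * (f (x + e) - f x) - psi e).
    by rewrite /GRing.scale/=; ring.
  apply: le_trans (ler_normB _ _) _; have := quot e e0 ex; lra.
apply: DeriveDef; first by apply/cvg_ex; exists (g x); exact: lim.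
exact/cvg_lim.
Unshelve. all: by end_near. Qed.

(** f - G has derivative 0 for t > 0, hence is constant there, and it tends to 0
    at 0. *)
Lemma forward_integral (f g G : R -> R) (K : R) :
  (forall a b, 0 < a -> a < b ->
    `|f b - f a - (b - a) * expR (- (b - a)) * g a| <= K * (b - a) ^+ 2) ->
  (forall b, 0 < b -> 0 <= f b <= K * b) ->
  (forall x : R, is_derive x 1 G (g x)) -> G 0 = 0 -> continuous g ->
  forall t, 0 < t -> f t = G t.
Proof.
move=> fg f0 dG G0 cg t t0.
have dD (x : R) : 0 < x -> is_derive x 1 (f - G) 0.
  move=> xp; rewrite -(subrr (g x)); apply: is_deriveB => //.
  exact: (is_derive_forward_estimate fg (cg x) xp).
have const s : 0 < s -> s < t -> f t - G t = f s - G s.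
  move=> s0 st; have [||c _ ] := @MVT_segment _ (f - G) (fun=> 0) s t (ltW st).
  - by move=> x; rewrite in_itv/= => /andP[sx _]; apply: dD; exact: lt_trans sx.
  - apply: derivable_within_continuous => x; rewrite in_itv/= => /andP[sx _].
    by have := dD x (lt_le_trans s0 sx).
  - by rewrite mul0r => /eqP; rewrite subr_eq0 => /eqP.
apply/eqP; rewrite -subr_eq0 -normr_le0; apply/ler_addgt0Pr => eps eps0.
have eps2 : 0 < eps / 2 by rewrite divr_gt0.
rewrite add0r.
have cG : G x @[x --> 0^'+] --> 0.
  rewrite -[X in _ --> X]G0; apply: cvg_at_right_filter.
  by apply: differentiable_continuous; apply/derivable1_diffP; case: (dG 0).
move/cvgrPdist_le: cG => /(_ (eps / 2) eps2) Gn.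
have K0 : 0 < 2 * (`|K| + 1) by rewrite mulr_gt0// ltr_wpDl.
have [s [[[s0 st] sK] Gs]] := filter_ex (filterI (filterI (filterI
  (nbhs_right_gt 0) (nbhs_right_lt t0))
  (nbhs_right_lt (divr_gt0 eps0 K0))) Gn).
rewrite (const s s0 st); have /andP[fs0 fsK] := f0 s s0.
have fs : `|f s| <= eps / 2.
  rewrite ger0_norm//; apply: le_trans fsK _.
  apply: (@le_trans _ _ ((`|K| + 1) * (eps / (2 * (`|K| + 1))))).
    have Kle : K <= `|K| + 1 by rewrite (le_trans (ler_norm K))// lerDl.
    apply: (le_trans (ler_wpM2r (ltW s0) Kle)).
    by rewrite ler_wpM2l ?addr_ge0// ltW.
  by rewrite le_eqVlt; apply/orP; left; apply/eqP; field; lra.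
move: Gs; rewrite /= sub0r normrN => Gs.
apply: le_trans (ler_normB _ _) _; lra.
Qed.

End Analysis.

Lemma continuous_big_nat {R : realType} n (F : nat -> R -> R) :
  (forall k, continuous (F k)) ->
  continuous (fun x => \sum_(0 <= k < n) F k x).
Proof.
move=> cF; elim: n => [|n IH] x.
  under eq_fun do rewrite big_geq//.
  exact: cvg_cst.
under eq_fun do rewrite big_nat_recr//=.
by apply: cvgD; [exact: IH|exact: cF].
Qed.

Lemma continuous_pois {R : realType} k : continuous (fun x : R => pois x k).
Proof.
move=> x; apply: cvgM.
  by apply: cvgM; [exact: exprn_continuous|exact: cvg_cst].
by apply: continuous_cvg; [exact: continuous_expR|apply: cvgN; exact: cvg_id].
Qed.

Lemma continuous_height_pmf {R : realType} h :
  continuous (@height_pmf R h).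
Proof.
apply: continuous_big_nat => k x; apply: cvgM; first exact: continuous_pois.
have ck := @continuous_pois R k x.
apply: cvgD; first by rewrite expr2; apply: cvgM.
apply: cvgM; first by apply: cvgM => //; exact: cvg_cst.
by apply: continuous_big_nat => j; exact: continuous_pois.
Qed.

Theorem theorem1 (R : realType) (d : measure_display)
    (Omega : measurableType d) (P : probability Omega R)
    (N : int -> R -> {RV P >-> nat})
    (kappa : R -> int -> nat -> {RV P >-> bool})
    (park : parking_system N kappa)
    (h : nat) (t : R) (t0 : 0 <= t) :
  density kappa t 0 h.+1 =
  (\sum_(0 <= k < h.+1)
      ('C(h, k)%:R * 'C(h + k, k)%:R * (1 / 3) ^+ (h + k).+1
       + 2 * 'C(h, k)%:R *
         \sum_(0 <= j < k) 'C(h + j, j)%:R * (1 / 3) ^+ (h + j).+1)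
   - (\sum_(0 <= k < h.+1)
      ('C(h, k)%:R * 'C(h + k, k)%:R * (1 / 3) ^+ (h + k).+1 *
         (\sum_(0 <= i < (h + k).+1) (3 * t) ^+ i / i`!%:R)
       + 2 * 'C(h, k)%:R *
         \sum_(0 <= j < k) ('C(h + j, j)%:R * (1 / 3) ^+ (h + j).+1 *
           \sum_(0 <= i < (h + j).+1) (3 * t) ^+ i / i`!%:R)))
     * expR (- (3 * t)))%:E.
Proof.
rewrite density_occupation -layer_densityE; congr (_%:E).
have occ0 b : 0 <= occupation kappa h b by exact: pr_ge0.
have := occupation_le park h t0.
move: t0; rewrite le_eqVlt => /predU1P[<-|tp].
  rewrite mulr0 layer_density0 => occ_le0.
  by apply/eqP; rewrite eq_le occ_le0 occ0.
move=> _; apply: (forward_integral (g := height_pmf h) (K := 6)) => //.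
- move=> a b a0 ab; have := occupation_step park h a0 ab.
  by rewrite /pois expr1 (factS 0) fact0 muln1 divr1.
- move=> b b0; rewrite occ0/=.
  apply: le_trans (occupation_le park h (ltW b0)) _.
  by rewrite ler_pM2r// ler_nat.
- exact: is_derive_layer_density.
- exact: layer_density0.
- exact: continuous_height_pmf.
Qed.
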